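(* Let $\mathcal{H}$ be a real Hilbert space, let $A:\mathcal{H}\rightrightarrows\mathcal{H}$ be maximal monotone with $A^{-1}(0)\neq\emptyset$ and with $\mathrm{dom}(A)$ closed and bounded, let $\theta>0$, let $p\geq1$ be an integer, and let $(x,\lambda):[0,+\infty)\to\mathcal{H}\times(0,+\infty)$ be a global solution of \[ \dot{x}(t)+x(t)-(I+\lambda(t)A)^{-1}x(t)=0,\qquad \lambda(t)\,\|(I+\lambda(t)A)^{-1}x(t)-x(t)\|^{p-1}=\theta, \] with $x(0)\in\{x\in\mathcal{H}:0\notin Ax\}$. Define \[ \tilde z(t)=\frac{1}{\int_0^t\lambda(s)\,ds}\int_0^t\lambda(s)(I+\lambda(s)A)^{-1}x(s)\,ds,\qquad z(t)=(I+\lambda(t)A)^{-1}x(t). \] Then $\textsc{gap}(\tilde z(t))=O(t^{-(p+1)/2})$ and $\textsc{res}(z(t))=O(t^{-p/2})$ as $t\to+\infty$.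
   Context: $\mathrm{dom}(A)=\{x:Ax\neq\emptyset\}$; $(I+\lambda A)^{-1}$ is the resolvent of index $\lambda$. The gap function is $\textsc{gap}(x)=\sup_{z\in\mathrm{dom}(A)}\sup_{\xi\in Az}\langle\xi,x-z\rangle$ and the residue function is $\textsc{res}(x)=\inf_{\xi\in Ax}\|\xi\|$. *)

(* Defs.v *)
From HB Require Import structures.
From mathcomp Require Import all_boot all_order all_algebra.
From mathcomp Require Import all_classical all_reals all_analysis.
Set Implicit Arguments. Unset Strict Implicit. Unset Printing Implicit Defensive.
Import Order.TTheory GRing.Theory Num.Theory.
Import numFieldNormedType.Exports.
Local Open Scope classical_set_scope.
Local Open Scope ring_scope.

Definition is_inner_product (R : realType) (H : normedModType R)
  (ip : H -> H -> R) : Prop :=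
  (forall x y, ip x y = ip y x) /\
  (forall a x y z, ip (a *: x + y) z = a * ip x z + ip y z) /\
  (forall x, ip x x = `|x| ^+ 2).

Definition dom (R : realType) (H : normedModType R) (A : H -> set H) : set H :=
  [set x | exists u, A x u].

Definition monotone_op (R : realType) (H : normedModType R)
  (ip : H -> H -> R) (A : H -> set H) : Prop :=
  forall x y u v, A x u -> A y v -> 0 <= ip (u - v) (x - y).

Definition maximal_monotone (R : realType) (H : normedModType R)
  (ip : H -> H -> R) (A : H -> set H) : Prop :=
  monotone_op ip A /\
  forall B : H -> set H, monotone_op ip B ->
    (forall x u, A x u -> B x u) -> forall x u, B x u -> A x u.

(* (I + lam A)^{-1} x : the (for maximal monotone A and lam > 0, unique) y
   with x ∈ y + lam A y. *)
Definition resolvent (R : realType) (H : normedModType R)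
  (A : H -> set H) (lam : R) (x : H) : H :=
  get [set y | exists2 u, A y u & x = y + lam *: u].

Definition gap (R : realType) (H : normedModType R)
  (ip : H -> H -> R) (A : H -> set H) (w : H) : \bar R :=
  ereal_sup [set e | exists z xi, A z xi /\ e = (ip xi (w - z))%:E].

(* res(w) = inf_{ξ ∈ A w} |ξ|  (in \bar R; +oo if A w is empty) *)
Definition res (R : realType) (H : normedModType R)
  (A : H -> set H) (w : H) : \bar R :=
  ereal_inf [set e | exists xi, A w xi /\ e = (`|xi|)%:E].

(* w is the weighted average (1/∫_0^t lam) ∫_0^t lam(s) J(s) ds, the
   H-valued integral being understood weakly: <v, w> equals the average of
   <v, lam(s) J(s)> for every v. *)
Definition is_weighted_avg (R : realType) (H : normedModType R)
  (ip : H -> H -> R) (lam : R -> R) (J : R -> H) (t : R) (w : H) : Prop :=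
  forall v : H,
    ip v w = (\int[@lebesgue_measure R]_(s in `[0, t]) lam s)^-1 *
             \int[@lebesgue_measure R]_(s in `[0, t]) (lam s * ip v (J s)).

(* Main.v *)
(**
Write y(t) for the resolvent at x(t) and e = x - y = -x', so that
u = e / lam lies in A y, and the closed loop law reads 1 / lam = |e|^n / theta
with n = p - 1.  The key fact is that |e| is nonincreasing: expanding the
monotonicity inequality <u(s) - u(t), y(s) - y(t)> >= 0 for t close to s shows
that |e(t)|^2 - |e(s)|^2 <= o(t - s), with no differentiability of e.
For a zero z of A, d/dt |x - z|^2 / 2 <= -|e|^2, so t |e(t)|^2 is bounded, and
res (y(t)) <= |u| = |e|^(n+1) / theta.  For xi in A z,
lam <xi, y - z> <= <e, x - z> = - d/dt |x - z|^2 / 2; integrating bounds the gap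
of the average by a constant over the integral of lam, which is at least
t/2 lam(t/2), lam being nondecreasing.

The resolvent is everywhere defined by Minty's theorem: the Fitzpatrick function
plus (|x|^2 + |u|^2) / 2 attains its minimum (a minimizing sequence is Cauchy by
the parallelogram law), and a minimizer is a point (x, -x) of the graph.
*)

Require Import Defs.
From HB Require Import structures.
From mathcomp Require Import all_boot all_order all_algebra.
From mathcomp Require Import all_classical all_reals all_analysis.
From mathcomp Require Import ring lra.
Import Order.TTheory GRing.Theory Num.Theory.
Import numFieldNormedType.Exports.
Local Open Scope classical_set_scope.
Local Open Scope ring_scope.
Set Implicit Arguments.
Unset Strict Implicit.

(** * Inner product calculus: Cauchy-Schwarz, continuity, derivatives *)

Section InnerProduct.
Context (R : realType) (H : normedModType R) (ip : H -> H -> R).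
Hypothesis Hip : is_inner_product ip.

Lemma ipC x y : ip x y = ip y x. Proof. by case: Hip. Qed.

Lemma ipxx x : ip x x = `|x| ^+ 2. Proof. by case: Hip => _ []. Qed.

Lemma ip0l y : ip 0 y = 0.
Proof.
case: Hip => _ [L _]; have := L 1 0 0 y; rewrite scaler0 addr0; lra.
Qed.

Lemma ipDl x y z : ip (x + y) z = ip x z + ip y z.
Proof. by case: Hip => _ [L _]; rewrite -{1}[x]scale1r L mul1r. Qed.

Lemma ipZl a x y : ip (a *: x) y = a * ip x y.
Proof. by case: Hip => _ [L _]; rewrite -[a *: x]addr0 L ip0l addr0. Qed.

Lemma ipNl x y : ip (- x) y = - ip x y.
Proof. by rewrite -scaleN1r ipZl mulN1r. Qed.

Lemma ipBl x y z : ip (x - y) z = ip x z - ip y z.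
Proof. by rewrite ipDl ipNl. Qed.

Lemma ipDr x y z : ip z (x + y) = ip z x + ip z y.
Proof. by rewrite !(ipC z) ipDl. Qed.

Lemma ipZr a x y : ip x (a *: y) = a * ip x y.
Proof. by rewrite !(ipC x) ipZl. Qed.

Lemma ipNr x y : ip x (- y) = - ip x y.
Proof. by rewrite !(ipC x) ipNl. Qed.

Lemma ipBr x y z : ip z (x - y) = ip z x - ip z y.
Proof. by rewrite !(ipC z) ipBl. Qed.

Definition ip_linear := (ipDl, ipDr, ipNl, ipNr, ipZl, ipZr).

Lemma normD2 x y : `|x + y| ^+ 2 = `|x| ^+ 2 + 2 * ip x y + `|y| ^+ 2.
Proof. rewrite -!ipxx !ip_linear (ipC y x); ring. Qed.

Lemma normB2 x y : `|x - y| ^+ 2 = `|x| ^+ 2 - 2 * ip x y + `|y| ^+ 2.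
Proof. rewrite normD2 ipNr normrN; ring. Qed.

(** Cauchy-Schwarz, from expanding the squared norm of [|y| x - |x| y]. *)
Lemma ip_le x y : ip x y <= `|x| * `|y|.
Proof.
have [->|x0] := eqVneq x 0; first by rewrite ip0l normr0 mul0r.
have [->|y0] := eqVneq y 0; first by rewrite ipC ip0l normr0 mulr0.
have P : 0 < `|x| * `|y| by rewrite mulr_gt0 ?normr_gt0.
have := sqr_ge0 `| `|y| *: x - `|x| *: y|.
rewrite normB2 !normrZ !normr_id !ip_linear => h.
rewrite -(ler_pM2l P); nra.
Qed.

Lemma normr_ip_le x y : `|ip x y| <= `|x| * `|y|.
Proof.
by rewrite ler_norml ip_le andbT lerNl -ipNl -[`|x|]normrN ip_le.
Qed.

Lemma ip_polar x y : ip x y = (`|x + y| ^+ 2 - `|x - y| ^+ 2) / 4.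
Proof. rewrite normD2 normB2; lra. Qed.

(** Polarization reduces the continuity of [ip] to that of the norm. *)
Lemma cvg_ip T (F : set_system T) {FF : Filter F} (f g : T -> H) u v :
  f @ F --> u -> g @ F --> v -> (fun t => ip (f t) (g t)) @ F --> ip u v.
Proof.
move=> fu gv; under eq_fun do rewrite ip_polar.
rewrite ip_polar; apply: cvgMl; apply: cvgB.
  by apply: (cvg_comp _ (fun r => r ^+ 2) (cvg_norm (cvgD fu gv)));
    exact: exprn_continuous.
by apply: (cvg_comp _ (fun r => r ^+ 2) (cvg_norm (cvgB fu gv)));
  exact: exprn_continuous.
Qed.

Lemma is_derive_ip (v : H) (x : R -> H) t : derivable x t 1 ->
  is_derive t 1 (fun s => ip v (x s)) (ip v ('D_1 x t)).
Proof.
move=> dx.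
have c : h^-1 *: (((fun s => ip v (x s)) \o shift t) (h *: 1) - ip v (x t))
    @[h --> 0^'] --> ip v ('D_1 x t).
  rewrite (_ : (fun h => _) =
      fun h => ip v (h^-1 *: ((x \o shift t) (h *: 1) - x t))).
    exact: cvg_ip (cvg_cst v) dx.
  by apply/funext => h; rewrite /= ipZr ipBr.
by split; [apply/cvg_ex; exists (ip v ('D_1 x t))|exact: cvg_lim c].
Qed.

Lemma is_derive_sqr_norm (x : R -> H) t : derivable x t 1 ->
  is_derive t 1 (fun s => `|x s| ^+ 2) (2 * ip (x t) ('D_1 x t)).
Proof.
move=> dx.
have cx : x (h *: 1 + t) @[h --> 0^'] --> x t.
  have c0 : (fun h : R => h *: (1 : R) + t) @ 0^' --> 0 + t.
    apply: cvgD; last exact: cvg_cst.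
    by under eq_fun do rewrite [_ *: _]mulr1; exact: cvg_within.
  have /differentiable_continuous cxt : differentiable x t.
    exact/derivable1_diffP.
  by rewrite add0r in c0; exact: (cvg_comp _ _ c0 cxt).
have c : h^-1 *: (((fun s => `|x s| ^+ 2) \o shift t) (h *: 1) - `|x t| ^+ 2)
    @[h --> 0^'] --> ip (x t + x t) ('D_1 x t).
  (* The difference quotient factors through [|a|^2 - |b|^2 = <a + b, a - b>]. *)
  rewrite (_ : (fun h => _) = fun h => ip (x (h *: 1 + t) + x t)
      (h^-1 *: ((x \o shift t) (h *: 1) - x t))).
    exact: cvg_ip (cvgD cx (cvg_cst (x t))) dx.
  apply/funext => h /=.
  rewrite ipZr ipBr !ipDl !ipxx (ipC (x t) (x _)); congr (_ *: _); ring.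
have -> : 2 * ip (x t) ('D_1 x t) = ip (x t + x t) ('D_1 x t).
  by rewrite ipDl; ring.
split; last exact: cvg_lim c.
by apply/cvg_ex; exists (ip (x t + x t) ('D_1 x t)).
Qed.

Lemma is_derive_sqr_dist (z : H) (x : R -> H) t : derivable x t 1 ->
  is_derive t 1 (fun s => `|x s - z| ^+ 2) (2 * ip (x t - z) ('D_1 x t)).
Proof.
move=> dx; have dz := derivable_cst z t (1 : R).
have := is_derive_sqr_norm (derivableB dx dz).
by rewrite deriveB// derive_cst subr0.
Qed.

End InnerProduct.

(** * Minty's theorem and existence of the resolvent *)

Section Minty.
Context (R : realType) (H : completeNormedModType R) (ip : H -> H -> R).
Hypothesis Hip : is_inner_product ip.

(** Adjoining [(q, w)] to the graph keeps it monotone, so maximality already puts it there. *)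
Lemma maximal_monotone_mem (A : H -> set H) q w : maximal_monotone ip A ->
  (forall y v, A y v -> 0 <= ip (w - v) (q - y)) -> A q w.
Proof.
move=> [mA maxA] h.
apply: (maxA (fun y v => A y v \/ (y = q /\ v = w))); last by right.
- move=> x y u v [Axu|[-> ->]] [Ayv|[-> ->]]; first exact: mA.
  + by have := h _ _ Axu;
    rewrite -(opprB u) -(opprB x) (ipNl Hip) (ipNr Hip) opprK.
  + exact: h.
  + by rewrite !subrr ip0l.
- by move=> x u Axu; left.
Qed.

Lemma cvg_dist_sqr (x : nat -> H) :
  (forall n m, `|x n - x m| ^+ 2 <= 4 * (n.+1%:R^-1 + m.+1%:R^-1)) ->
  cvg (x @ \oo).
Proof.
move=> h; apply/cauchy_cvgP/cauchy_exP => e e0.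
have [N _ hN] : \forall n \near \oo, n.+1%:R^-1 < e ^+ 2 / 8 :> R.
  have e8 : 0 < e ^+ 2 / 8 by rewrite divr_gt0 ?exprn_gt0.
  exact: near_infty_natSinv_lt (PosNum e8).
exists (x N); exists N => // n /= Nn; rewrite -ball_normE/=.
rewrite -(ltr_pXn2r (ltn0Sn 1)) ?nnegrE ?(ltW e0)//.
apply: le_lt_trans (h _ _) _.
have {hN} lt k : (N <= k)%N -> (k.+1%:R^-1 : R) < e ^+ 2 / 8 by exact: hN.
rewrite (_ : e ^+ 2 = 4 * (e ^+ 2 / 8 + e ^+ 2 / 8)); last by field.
by rewrite ltr_pM2l// ltrD// lt.
Qed.

(* The epigraph of the Fitzpatrick function
   [(x, u) |-> sup_(v \in A y) (<x, v> + <y, u> - <y, v>)]. *)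
Definition fitz_epi (A : H -> set H) (x u : H) (r : R) : Prop :=
  forall y v, A y v -> ip x v + ip y u - ip y v <= r.

Lemma fitz_epi_graph A y v : monotone_op ip A -> A y v ->
  fitz_epi A y v (ip y v).
Proof.
move=> mA Ayv z w Azw; have := mA _ _ _ _ Ayv Azw.
rewrite !(ip_linear Hip).
have := (ipC Hip v y, ipC Hip w y, ipC Hip v z, ipC Hip w z) => -[[[]]]; lra.
Qed.

Lemma fitz_epi_conv A x u r x' u' r' s : 0 <= s -> s <= 1 ->
  fitz_epi A x u r -> fitz_epi A x' u' r' ->
  fitz_epi A (x + s *: (x' - x)) (u + s *: (u' - u)) (r + s * (r' - r)).
Proof.
move=> s0 s1 C C' y v Ayv; have := C _ _ Ayv; have := C' _ _ Ayv.
rewrite !(ip_linear Hip) => h1 h2; nra.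
Qed.

(** If [r] were below [<x, u>], the epigraph inequalities would make [(x, u)] monotonically related
    to the whole graph, hence a point of it; testing at that point itself is then contradictory. *)
Lemma fitz_epi_ge A x u r : maximal_monotone ip A -> (exists y v, A y v) ->
  fitz_epi A x u r -> ip x u <= r.
Proof.
move=> maxA [y0 [v0 A0]] C; rewrite leNgt; apply/negP => rlt.
have Axu : A x u.
  apply: maximal_monotone_mem maxA _ => y v /C.
  rewrite !(ip_linear Hip).
  have := (ipC Hip v x, ipC Hip u x, ipC Hip u y, ipC Hip v y) => -[[[]]]; lra.
have := C _ _ Axu; lra.
Qed.

Lemma fitz_min A : maximal_monotone ip A -> (exists y v, A y v) ->
  exists x u r, fitz_epi A x u r /\ forall x' u' r', fitz_epi A x' u' r' ->
    r + (`|x| ^+ 2 + `|u| ^+ 2) / 2 <= r' + (`|x'| ^+ 2 + `|u'| ^+ 2) / 2.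
Proof.
move=> maxA neA.
pose G (x u : H) (r : R) := r + (`|x| ^+ 2 + `|u| ^+ 2) / 2.
pose S := [set g | exists x u r, fitz_epi A x u r /\ g = G x u r].
have S0 : has_inf S.
  split.
    case: neA => y [v Ayv]; exists (G y v (ip y v)), y, v, (ip y v).
    by split => //; apply: fitz_epi_graph => //; case: maxA.
  (* Since [r >= <x, u>], the value is at least [|x + u|^2 / 2]. *)
  exists 0 => _ [x [u [r [C ->]]]]; rewrite /G.
  have := fitz_epi_ge maxA neA C; have := sqr_ge0 `|x + u|.
  rewrite (normD2 Hip); lra.
pose m := inf S.
have mle x u r : fitz_epi A x u r -> m <= G x u r.
  by move=> C; apply: ge_inf; [case: S0|exists x, u, r].
have /choice[c hc] : forall n : nat, exists c : H * H * R,
    fitz_epi A c.1.1 c.1.2 c.2 /\ G c.1.1 c.1.2 c.2 < m + n.+1%:R^-1.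
  move=> n; have n0 : (0 : R) < n.+1%:R^-1 by rewrite invr_gt0 ltr0n.
  have [_ [x [u [r [C ->]]]] lt] := inf_adherent n0 S0.
  by exists (x, u, r).
pose x n := (c n).1.1; pose u n := (c n).1.2; pose r n := (c n).2.
have half0 : 0 <= (2 : R)^-1 by rewrite invr_ge0.
have half1 : (2 : R)^-1 <= 1 by rewrite invf_le1// ler1n.
(* The midpoint of two near-minimizers has value at least [m]; the parallelogram law turns this into
   a bound on their distance. *)
have D n k : `|x n - x k| ^+ 2 + `|u n - u k| ^+ 2 <=
    4 * (n.+1%:R^-1 + k.+1%:R^-1).
  have [Cn Gn] := hc n; have [Ck Gk] := hc k.
  have := mle _ _ _ (fitz_epi_conv half0 half1 Cn Ck).
  move: Gn Gk; rewrite /G -/(x n) -/(x k) -/(u n) -/(u k) -/(r n) -/(r k).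
  rewrite !(normD2 Hip) !normrZ !exprMn !(normD2 Hip) !normrN.
  rewrite !(ip_linear Hip) !(ipxx Hip).
  have -> : `|(2 : R)^-1| = 2^-1 by rewrite ger0_norm.
  rewrite (ipC Hip (x k)) (ipC Hip (u k)).
  move: (n.+1%:R^-1) (k.+1%:R^-1) => a b; lra.
have /cvg_ex[x0 cx] : cvg (x @ \oo).
  apply: cvg_dist_sqr => n k; apply: le_trans (D n k).
  by rewrite lerDl sqr_ge0.
have /cvg_ex[u0 cu] : cvg (u @ \oo).
  apply: cvg_dist_sqr => n k; apply: le_trans (D n k).
  by rewrite lerDr sqr_ge0.
(* This [r] makes the value exactly [m]. It remains to pass to the limit in each inequality defining
   the epigraph. *)
exists x0, u0, (m - (`|x0| ^+ 2 + `|u0| ^+ 2) / 2); split; last first.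
  by move=> x' u' r' /mle; rewrite /G; lra.
move=> y v Ayv.
have cn2 (z : nat -> H) z0 : z @ \oo --> z0 ->
    (fun n => `|z n| ^+ 2) @ \oo --> `|z0| ^+ 2.
  move=> /cvg_norm cz; rewrite expr2; under eq_fun do rewrite expr2.
  exact: cvgM.
pose f n := ip (x n) v + ip y (u n) - ip y v + (`|x n| ^+ 2 + `|u n| ^+ 2) / 2.
have cf : f @ \oo -->
    ip x0 v + ip y u0 - ip y v + (`|x0| ^+ 2 + `|u0| ^+ 2) / 2.
  apply: cvgD; last by apply: cvgMl; apply: cvgD; exact: cn2.
  apply: cvgB; last exact: cvg_cst.
  apply: cvgD; first exact: (cvg_ip Hip cx (cvg_cst v)).
  exact: (cvg_ip Hip (cvg_cst y) cu).
suff : ip x0 v + ip y u0 - ip y v + (`|x0| ^+ 2 + `|u0| ^+ 2) / 2 <= m by lra.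
apply/ler_addgt0Pr => e e0; apply: (cvgr_to_le cf).
near=> n; have [Cn Gn] := hc n.
have ne : n.+1%:R^-1 < e :> R.
  by near: n; exact: near_infty_natSinv_lt (PosNum e0).
have := Cn _ _ Ayv; move: Gn ne; rewrite /G /f -/(x n) -/(u n) -/(r n).
move: (n.+1%:R^-1) => a; lra.
Unshelve. all: by end_near. Qed.

Lemma minty0 A : maximal_monotone ip A -> (exists y v, A y v) ->
  exists y, A y (- y).
Proof.
move=> maxA neA; have [x [u [r [C min]]]] := fitz_min maxA neA.
have xur := fitz_epi_ge maxA neA C.
(* First-order optimality along the segment towards [(y, v, <y, v>)]. *)
have VI y v : A y v -> 0 <= ip y v - r + ip x (y - x) + ip u (v - u).
  move=> Ayv; rewrite leNgt; apply/negP => lt0.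
  have Cyv := fitz_epi_graph (proj1 maxA) Ayv.
  set a := (X in X < 0) in lt0.
  pose b := (`|y - x| ^+ 2 + `|v - u| ^+ 2) / 2.
  have b0 : 0 <= b by rewrite divr_ge0 ?addr_ge0 ?sqr_ge0.
  have st s : 0 < s <= 1 -> 0 <= a + s * b.
    move=> /andP[s0 s1].
    have /min : fitz_epi A (x + s *: (y - x)) (u + s *: (v - u))
        (r + s * (ip y v - r)) by apply: fitz_epi_conv => //; rewrite ltW.
    rewrite (normD2 Hip x) (normD2 Hip u) !(ipZr Hip) !normrZ (gtr0_norm s0).
    rewrite !exprMn => h.
    rewrite -(pmulr_rge0 _ s0) /a /b; lra.
  have ab : 0 < b - a by lra.
  (* This [s] lies in []0, 1]] and gives [a + s b = - a^2 / (b - a) < 0]. *)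
  have := st (- a / (b - a)); rewrite divr_gt0//; last lra.
  rewrite ler_pdivrMr// mul1r => /(_ ltac:(lra)).
  have -> : a + - a / (b - a) * b = - (a ^+ 2) / (b - a) by field; lra.
  rewrite pmulr_lge0 ?invr_gt0// oppr_ge0 leNgt; case/negP.
  by rewrite exprn_even_gt0//= lt_eqF.
(* With [r >= <x, u>], [VI] bounds [<x + v, u + y>] below by [|x + u|^2]. *)
have Anu : A (- u) (- x).
  apply: maximal_monotone_mem maxA _ => y v /VI.
  have := sqr_ge0 `|x + u|; rewrite (normD2 Hip) !(ip_linear Hip) !(ipxx Hip).
  have := (ipC Hip v u, ipC Hip v y, ipC Hip y x) => -[[]]; lra.
(* At [(- u, - x)] itself, [VI] gives [|x + u|^2 <= 0], so [u = - x]. *)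
have := VI _ _ Anu; have := sqr_ge0 `|x + u|; rewrite (normD2 Hip).
rewrite !(ip_linear Hip) !(ipxx Hip) => h1 h2.
have ux := ipC Hip u x.
have /eqP : `|x + u| ^+ 2 = 0 by rewrite (normD2 Hip); lra.
rewrite expf_eq0/= normr_eq0 addrC addr_eq0 => /eqP u_x.
by exists x; move: Anu; rewrite u_x opprK.
Qed.

(** Minty's theorem for [B y = lam A y - x], maximal monotone like [A]: [- y] in [B y] means [x] in
    [y + lam A y], so the set under [get] is inhabited. *)
Lemma resolventP A lam x : maximal_monotone ip A -> (exists y v, A y v) ->
  0 < lam -> A (resolvent A lam x) (lam^-1 *: (x - resolvent A lam x)).
Proof.
move=> [mA maxA] [y0 [v0 A0]] l0.
have ln0 : lam != 0 by rewrite gt_eqF.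
pose B y w := A y (lam^-1 *: (w + x)).
have AB y v : A y v -> B y (lam *: v - x).
  by rewrite /B subrK scalerA mulVf// scale1r.
have maxB : maximal_monotone ip B.
  split=> [y z u v Byu Bzv|C mC BC y w Cyw].
    have := mA _ _ _ _ Byu Bzv; rewrite -scalerBr (ipZl Hip).
    by rewrite pmulr_rge0 ?invr_gt0// opprD addrACA subrr addr0.
  apply: (maxA (fun y v => C y (lam *: v - x))).
  - move=> a b u v Ca Cb; have := mC _ _ _ _ Ca Cb.
    by rewrite opprB addrA subrK -scalerBr (ipZl Hip) pmulr_rge0.
  - by move=> a u /AB/BC.
  - by rewrite scalerA mulfV// scale1r addrK.
have [|y By] := minty0 maxB; first by exists y0, (lam *: v0 - x); exact: AB.
have /getPex : exists y, [set y | exists2 u, A y u & x = y + lam *: u] y.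
  exists y; exists (lam^-1 *: (x - y)); first by rewrite addrC.
  by rewrite scalerA mulfV// scale1r addrC subrK.
rewrite -/(resolvent A lam x) => -[u Au xE].
suff -> : lam^-1 *: (x - resolvent A lam x) = u by [].
by rewrite {1}xE addrC addKr scalerA mulVf// scale1r.
Qed.

End Minty.

(** * Real analysis: a Lipschitz bound and a Dini criterion for monotonicity *)

Section RealAnalysis.
Context (R : realType).

(** Serves to make [1 / lam], a multiple of [|e|^n], Lipschitz in [|e|] on bounded sets. *)
Lemma expr_lipschitz n (M : R) : 0 <= M -> exists2 K, 0 <= K &
  forall a b, 0 <= a <= M -> 0 <= b <= M -> `|a ^+ n - b ^+ n| <= K * `|a - b|.
Proof.
move=> M0; elim: n => [|n [K K0 IH]].
  by exists 0 => // a b _ _; rewrite !expr0 subrr normr0 mul0r.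
exists (M * K + M ^+ n); first by rewrite addr_ge0 ?mulr_ge0 ?exprn_ge0.
move=> a b aM bM; have /andP[a0 aleM] := aM; have /andP[b0 bleM] := bM.
rewrite (_ : a ^+ n.+1 - b ^+ n.+1 = a * (a ^+ n - b ^+ n) + (a - b) * b ^+ n);
  last by rewrite !exprS; ring.
have h1 : a * `|a ^+ n - b ^+ n| <= M * (K * `|a - b|) by rewrite ler_pM// IH.
have h2 : `|a - b| * b ^+ n <= `|a - b| * M ^+ n.
  by rewrite ler_wpM2l// lerXn2r ?nnegrE.
rewrite (le_trans (ler_normD _ _))// !normrM (ger0_norm a0).
rewrite (ger0_norm (exprn_ge0 _ b0)); lra.
Qed.

Lemma within_nbhs_lt (V : normedModType R) (f : R -> V) s (eps : R) :
  {within `[0, +oo[, continuous f} -> 0 <= s -> 0 < eps ->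
  exists2 d : R, 0 < d &
    forall r, 0 <= r -> `|s - r| < d -> `|f s - f r| < eps.
Proof.
move=> /subspace_continuousP cf s0 e0.
have /cf/cvgrPdist_lt/(_ _ e0) : `[0, +oo[%classic s by rewrite /= in_itv/= s0.
rewrite near_withinE => /nbhs_ballP[d d0 hd]; exists d => // r r0 rd.
by apply: hd; rewrite /ball//= in_itv/= r0.
Qed.

Lemma within_continuous_sqr_norm (V : normedModType R) (S : set R)
  (f : R -> V) : {within S, continuous f} ->
  {within S, continuous (fun r => `|f r| ^+ 2)}.
Proof.
move=> cf r; apply: (cvg_comp _ (fun u => u ^+ 2) (cvg_norm (cf r))).
exact: exprn_continuous.
Qed.

(** The second premise says that the upper right Dini derivative is nonpositive. The points reached
    from [s] with slope at most [k] have a supremum that is reached too, by continuity, and that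
    could be pushed further if it were below [t]. *)
Lemma nonincreasing_right_dini (f : R -> R) :
  {within `[0, +oo[, continuous f} ->
  (forall s eps, 0 <= s -> 0 < eps -> exists2 d : R, 0 < d &
    forall t, s < t -> t - s < d -> f t - f s <= eps * (t - s)) ->
  forall s t, 0 <= s -> s <= t -> f t <= f s.
Proof.
move=> cf dini s t s0 st; apply/ler_addgt0Pr => e e0.
have [->|nst] := eqVneq s t; first by rewrite lerDl ltW.
have {nst}st : s < t by rewrite lt_neqAle nst.
(* The slope for which the allowed growth over [[s, t]] is exactly [e]. *)
pose k := e / (t - s); have k0 : 0 < k by rewrite divr_gt0// subr_gt0.
suff : f t - f s <= k * (t - s) by rewrite divfK ?subr_eq0 ?gt_eqF//; lra.
pose S := [set r | s <= r <= t /\ f r - f s <= k * (r - s)].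
have Ss : S s by rewrite /S/= lexx ltW// !subrr mulr0.
have supS : has_sup S.
  by split; [exists s|exists t => r [/andP[]]].
pose m := sup S.
have sm : s <= m by apply: ub_le_sup Ss; case: supS.
have mt : m <= t by apply: ge_sup; [exists s|move=> r [/andP[]]].
have m0 : 0 <= m by apply: le_trans sm.
have Sm : f m - f s <= k * (m - s).
  apply/ler_addgt0Pr => eps eps0.
  have eps2 : 0 < eps / 2 by rewrite divr_gt0.
  have [d d0 hd] := within_nbhs_lt cf m0 eps2.
  have [r [/andP[sr rt] fr] mr] := sup_adherent d0 supS.
  have rm : r <= m by apply: ub_le_sup; [case: supS|split => //; apply/andP].
  rewrite -/m in mr; have : `|f m - f r| < eps / 2.
    by apply: hd; [exact: le_trans sr|rewrite ger0_norm ?subr_ge0//; lra].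
  move=> /ltr_normlW h.
  have : k * (r - s) <= k * (m - s) by rewrite ler_pM2l// lerD2r.
  lra.
have [tm|mlt] := leP t m; first by rewrite (_ : t = m)//; apply/le_anti/andP.
have [d d0 hd] := dini m k m0 k0.
pose r := Num.min t (m + d / 2).
have mr : m < r by rewrite lt_min mlt ltrDl divr_gt0.
have : S r.
  split; first by rewrite (ltW (le_lt_trans sm mr)) ge_min lexx.
  have : r <= m + d / 2 by rewrite ge_min lexx orbT.
  have d2 : d / 2 < d by lra.
  move=> rd; have /hd := mr => /(_ ltac:(lra)); lra.
by move/(ub_le_sup (proj2 supS)); rewrite -/m leNgt mr.
Qed.

Lemma segment_sub_halfline (a b : R) : 0 <= a -> `[a, b] `<=` `[0, +oo[%classic.
Proof.
move=> a0 r; rewrite /= !in_itv/= andbT => /andP[ar _].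
exact: le_trans ar.
Qed.

Lemma within_segment_integrable (f : R -> R) (a b : R) :
  {within `[a, b], continuous f} ->
  (@lebesgue_measure R).-integrable `[a, b] (EFin \o f).
Proof. by apply: continuous_compact_integrable; exact: segment_compact. Qed.

End RealAnalysis.

(** * Estimates for one time step and for resolvents *)

Section ResolventEstimates.
Context (R : realType) (H : completeNormedModType R) (ip : H -> H -> R).
Hypothesis Hip : is_inner_product ip.

(* With [w] close to the midpoint of [e1] and [e2] and [h] a time step, this is
   the discrete form of: [<(g e)', e' + e> <= 0] and [g] increasing with [|e|]
   force [|e|] to be nonincreasing. *)
Lemma sqr_norm_step (e1 e2 w : H) (g1 g2 gm L eta h : R) :
  0 < gm -> gm <= g1 -> gm <= g2 -> 0 <= L -> 0 <= eta -> 0 < h ->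
  (`|e1| <= `|e2| -> g1 <= g2) ->
  ip (g1 *: e1 - g2 *: e2) (e1 - e2) <= h * ip (g1 *: e1 - g2 *: e2) w ->
  `|w - 2^-1 *: (e1 + e2)| <= eta ->
  `|g1 *: e1 - g2 *: e2| <= L * `|e1 - e2| ->
  `|e2| ^+ 2 - `|e1| ^+ 2 <= h * (L * eta / gm) ^+ 2.
Proof.
move=> gm0 g1m g2m L0 eta0 h0 gle hvw hw hL.
have [a21|a12] := ltP `|e2| `|e1|.
  apply: (@le_trans _ _ 0); last by rewrite mulr_ge0 ?sqr_ge0// ltW.
  by rewrite subr_le0 lerXn2r ?nnegrE ?normr_ge0// ltW.
have {gle}g12 := gle a12.
set v := g1 *: e1 - g2 *: e2 in hvw hL *; set D := `|e1 - e2| in hL *.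
set X := _ - _ ^+ 2.
have q1 := ip_le Hip e1 e2; have q2 : - (`|e1| * `|e2|) <= ip e1 e2.
  by have := normr_ip_le Hip e1 e2; rewrite ler_norml => /andP[].
(* The pairing equals [(g1 + g2) / 2 * D^2 + (g2 - g1) * X / 2], where [g2 - g1] and [X] are
   nonnegative. *)
have vd : gm * D ^+ 2 <= ip v (e1 - e2).
  rewrite /v /D (normB2 Hip) !(ip_linear Hip) !(ipxx Hip) (ipC Hip e2 e1).
  have := sqr_ge0 (`|e2| - `|e1|); have := normr_ge0 e1; have := normr_ge0 e2.
  move: q1 a12; move: `|e1| `|e2| (ip e1 e2) => a b q qab ab b0 a0 _.
  have D0 : 0 <= a ^+ 2 - 2 * q + b ^+ 2 by nra.
  have : 0 <= (g2 - g1) * (b ^+ 2 - a ^+ 2) by rewrite mulr_ge0; nra.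
  nra.
(* With [a], [b] the two norms, Cauchy-Schwarz leaves [(g1 a + g2 b) (b - a)], at least
   [gm (a + b) (b - a)]. *)
have vs : gm * X <= - ip v (e1 + e2).
  rewrite /v /X !(ip_linear Hip) !(ipxx Hip) (ipC Hip e2 e1).
  have := normr_ge0 e1; have := normr_ge0 e2.
  move: q2 a12; move: `|e1| `|e2| (ip e1 e2) => a b q qab ab b0 a0.
  have h1 : 0 <= (g2 - g1) * (q + a * b) by rewrite mulr_ge0; nra.
  have h2 : 0 <= (g1 - gm) * (a * (b - a)) by rewrite mulr_ge0 ?mulr_ge0; nra.
  have h3 : 0 <= (g2 - gm) * (b * (b - a)) by rewrite mulr_ge0 ?mulr_ge0; nra.
  nra.
have vw : ip v w <= - (gm * X / 2) + L * D * eta.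
  have -> : w = 2^-1 *: (e1 + e2) + (w - 2^-1 *: (e1 + e2)).
    by rewrite addrC subrK.
  rewrite (ipDr Hip) (ipZr Hip); apply: lerD; first lra.
  apply: le_trans (ip_le Hip _ _) _.
  by rewrite ler_pM.
have main : h * (gm * X / 2) <= h * (L * D * eta) - gm * D ^+ 2.
  have : h * ip v w <= h * (- (gm * X / 2) + L * D * eta) by rewrite ler_pM2l.
  lra.
rewrite -(ler_pM2l (_ : 0 < h * gm / 2)); last by rewrite divr_gt0// mulr_gt0.
have -> : h * gm / 2 * (h * (L * eta / gm) ^+ 2) =
    (h * (L * eta)) ^+ 2 / gm / 2.
  by field; rewrite gt_eqF.
have -> : h * gm / 2 * X = h * (gm * X / 2) by ring.
apply: (le_trans main).
(* Completing the square eliminates [D]: [Y D - gm D^2 <= Y^2 / (4 gm)], half of what is allowed. *)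
have := sqr_ge0 (h * (L * eta) - 2 * gm * D).
set Y := h * (L * eta).
have -> : h * (L * D * eta) = Y * D by rewrite /Y; ring.
rewrite ler_pdivlMr// ler_pdivlMr//; nra.
Qed.

(** Monotonicity scaled by [l1] bounds [|y1 - y2|^2] by the pairing of [y1 - y2] with
    [x1 - x2 + (1 - l1 / l2) (x2 - y2)]; Cauchy-Schwarz concludes. This gives continuity in index
    and point at once. *)
Lemma resolvent_dist (A : H -> set H) (l1 l2 : R) (x1 x2 : H) :
  maximal_monotone ip A -> (exists y v, A y v) -> 0 < l1 -> 0 < l2 ->
  `|resolvent A l1 x1 - resolvent A l2 x2| <=
    `|x1 - x2| + `|1 - l1 / l2| * `|x2 - resolvent A l2 x2|.
Proof.
move=> maxA neA l10 l20.
have := (proj1 maxA) _ _ _ _ (resolventP Hip x1 maxA neA l10)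
  (resolventP Hip x2 maxA neA l20).
set y1 := resolvent A l1 x1; set y2 := resolvent A l2 x2 => mono.
have [d0|d0] := eqVneq (y1 - y2) 0.
  by rewrite d0 normr0 addr_ge0 ?mulr_ge0 ?normr_ge0.
have : 0 <= l1 * ip (l1^-1 *: (x1 - y1) - l2^-1 *: (x2 - y2)) (y1 - y2).
  by rewrite mulr_ge0// ltW.
rewrite -(ipZl Hip) scalerBr !scalerA mulfV ?gt_eqF// scale1r.
have -> : (x1 - y1) - (l1 / l2) *: (x2 - y2) =
    ((x1 - x2) + (1 - l1 / l2) *: (x2 - y2)) - (y1 - y2).
  rewrite scalerBl scale1r [in RHS]addrA [in RHS]addrA subrK opprB.
  by rewrite [in RHS]addrAC [in RHS]addrA subrK addrAC.
rewrite (ipBl Hip) (ipxx Hip) subr_ge0 => le1.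
have := le_trans le1 (ip_le Hip _ _).
rewrite expr2 ler_pM2r ?normr_gt0// => /le_trans; apply.
by rewrite (le_trans (ler_normD _ _))// normrZ.
Qed.

End ResolventEstimates.

(** * Along the trajectory: monotonicity and decay of the residual, and the integrated gap
    inequality *)

Definition residual (R : realType) (H : normedModType R) (A : H -> set H)
    (lam : R -> R) (x : R -> H) (t : R) : H :=
  x t - resolvent A (lam t) (x t).

Section Trajectory.
Context (R : realType) (H : completeNormedModType R) (ip : H -> H -> R).
Context (A : H -> set H) (theta : R) (n : nat) (x : R -> H) (lam : R -> R).
Hypothesis Hip : is_inner_product ip.
Hypothesis maxA : maximal_monotone ip A.
Hypothesis neA : exists y v, A y v.
Hypothesis theta0 : 0 < theta.
Hypothesis lam0 : forall t : R, 0 <= t -> 0 < lam t.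
Hypothesis cx : {within `[0, +oo[, continuous x}.
Hypothesis clam : {within `[0, +oo[, continuous lam}.
Hypothesis dx : forall t : R, 0 < t -> derivable x t 1.
Hypothesis ode : forall t : R, 0 < t ->
  'D_1 x t + x t - resolvent A (lam t) (x t) = 0.
Hypothesis law : forall t : R, 0 <= t ->
  lam t * `|resolvent A (lam t) (x t) - x t| ^+ n = theta.

Local Notation e := (residual A lam x).

Lemma velocityE (t : R) : 0 < t -> 'D_1 x t = - e t.
Proof. by move=> /ode /eqP; rewrite -addrA addr_eq0 => /eqP. Qed.

Lemma resolventE (t : R) : resolvent A (lam t) (x t) = x t - e t.
Proof. by rewrite /residual opprB addrC subrK. Qed.

Lemma lawE (t : R) : 0 <= t -> lam t * `|e t| ^+ n = theta.
Proof. by move=> /law; rewrite distrC. Qed.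

Lemma inv_lamE (t : R) : 0 <= t -> (lam t)^-1 = `|e t| ^+ n / theta.
Proof.
move=> t0; rewrite -(lawE t0) invfM mulrCA mulfV ?mulr1//.
apply: contra_eq_neq (lawE t0) => ->.
by rewrite mulr0 lt_eqF.
Qed.

Lemma residualP (t : R) : 0 <= t -> A (x t - e t) ((lam t)^-1 *: e t).
Proof.
by move=> t0; rewrite -resolventE; exact: (resolventP Hip _ maxA neA (lam0 t0)).
Qed.

Lemma residual_continuous : {within `[0, +oo[, continuous e}.
Proof.
apply/subspace_continuousP => s s_ge0.
have s0 : 0 <= s by move: s_ge0; rewrite /= in_itv/= andbT.
have /subspace_continuousP/(_ _ s_ge0) cxs := cx.
have /subspace_continuousP/(_ _ s_ge0) cls := clam.
apply: cvgB => //.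
apply/cvgrPdist_le => eps eps0.
(* The bound of [resolvent_dist] with the second point frozen at [s]; it tends to 0 there. *)
pose phi t := `|x t - x s| + `|1 - lam t / lam s| * `|e s|.
have phis : phi s = 0.
  by rewrite /phi mulfV ?gt_eqF ?lam0// !subrr !normr0 mul0r addr0.
have cphi : phi @ within `[0, +oo[%classic (nbhs s) --> phi s.
  apply: cvgD; first exact: cvg_norm (cvgB cxs (cvg_cst _)).
  apply: cvgMl; apply: cvg_norm; apply: cvgB; first exact: cvg_cst.
  exact: cvgMl.
rewrite phis in cphi.
near=> t; rewrite distrC.
have t0 : 0 <= t.
  near: t; rewrite near_withinE; apply: nearW => r.
  by rewrite /= in_itv/= andbT.
apply: (le_trans (resolvent_dist Hip _ _ maxA neA (lam0 t0) (lam0 s0))).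
rewrite -[leLHS]/(phi t).
by near: t; apply: (cvgr_le _ cphi).
Unshelve. all: by end_near. Qed.

(** The Dini criterion for [|e|^2]: [sqr_norm_step] over the time step [t - s] limits the growth to
    [eps (t - s)]. *)
Lemma norm_residual_nonincreasing (s t : R) :
  0 <= s -> s <= t -> `|e t| <= `|e s|.
Proof.
move=> s0 st; rewrite -(ler_pXn2r (ltn0Sn 1)) ?nnegrE//.
apply: (@nonincreasing_right_dini _ (fun r => `|e r| ^+ 2)) s t s0 st.
  exact: within_continuous_sqr_norm residual_continuous.
move=> s eps s0 eps0.
pose M := `|e s| + 1; have M0 : 0 <= M by rewrite addr_ge0.
have [K K0 lipK] := expr_lipschitz n M0.
pose g1 := (lam s)^-1; have g10 : 0 < g1 by rewrite invr_gt0 lam0.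
(* A Lipschitz constant at [e s] for [e / lam], seen as [|e|^n e / theta], on the ball of radius
   [M]. *)
pose L := g1 + K / theta * M.
have L0 : 0 < L.
  by rewrite ltr_wpDr// !mulr_ge0// invr_ge0 ltW.
have gm0 : 0 < g1 / 2 by rewrite divr_gt0.
(* Tuned so that the constant of [sqr_norm_step] is exactly [eps]. *)
pose eta := g1 / 2 * Num.sqrt eps / L.
have eta0 : 0 < eta by rewrite divr_gt0// mulr_gt0// sqrtr_gt0.
have etaE : (L * eta / (g1 / 2)) ^+ 2 = eps.
  rewrite /eta -[RHS](sqr_sqrtr (ltW eps0)); congr (_ ^+ 2); field.
  by rewrite !gt_eqF.
(* The bound 1 keeps [|e t|] below [M]; [eta / 2] keeps [e c] within [eta] of the midpoint of [e s]
   and [e t]. *)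
have min0 : 0 < Num.min 1 (eta / 2) by rewrite lt_min ltr01 divr_gt0.
have [d1 d10 near_e] := within_nbhs_lt residual_continuous s0 min0.
(* Tolerance [lam s] gives [lam t < 2 lam s], whence [g1 / 2 <= g2]. *)
have [d2 d20 near_lam] := within_nbhs_lt clam s0 (lam0 s0).
exists (Num.min d1 d2); first by rewrite lt_min d10.
move=> t st; rewrite lt_min => /andP[td1 td2].
have t0 : 0 <= t by rewrite (le_trans s0)// ltW.
have dst r : s <= r -> `|s - r| = r - s.
  by move=> sr; rewrite distrC ger0_norm// subr_ge0.
have close r : s <= r -> r <= t -> `|e s - e r| < 1 /\ `|e s - e r| < eta / 2.
  move=> sr rt; have /near_e : 0 <= r by exact: le_trans sr.
  rewrite dst// lt_min => /(_ _)/andP; apply.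
  by apply: le_lt_trans td1; rewrite lerD2r.
pose g2 := (lam t)^-1.
have g2m : g1 / 2 <= g2.
  have : `|lam s - lam t| < lam s by apply: near_lam; rewrite ?dst// ltW.
  rewrite ltr_norml => /andP[lt1 _].
  have -> : g1 / 2 = (lam s * 2)^-1 by rewrite invfM.
  rewrite /g2 lef_pV2 ?posrE ?mulr_gt0 ?lam0//; lra.
pose v := g1 *: e s - g2 *: e t.
(* Pairing with the fixed vector [v] permits a scalar mean value theorem; its point [c] supplies
   [w = e c]. *)
have [c cst mvt] : exists2 c, c \in `]s, t[ &
    ip v (x t) - ip v (x s) = ip v ('D_1 x c) * (t - s).
  apply: (@MVT _ (fun r => ip v (x r)) (fun r => ip v ('D_1 x r))) => //.
    move=> r; rewrite in_itv/= => /andP[sr _].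
    by apply: (is_derive_ip Hip); apply: dx; exact: le_lt_trans sr.
  have cxst := continuous_subspaceW (@segment_sub_halfline _ s t s0) cx.
  move=> r; apply: (cvg_ip Hip); first exact: cvg_cst.
  exact: cxst.
move: cst; rewrite in_itv/= => /andP[sc ct].
rewrite -etaE mulrC.
apply: (@sqr_norm_step _ _ _ Hip _ _ (e c) g1 g2 _ L eta) => //.
- by rewrite ler_pdivrMr// ler_peMr ?ler1n// ltW.
- exact: ltW.
- exact: ltW.
- by rewrite subr_gt0.
- move=> le12; rewrite /g1 /g2 !inv_lamE// ler_pM2r ?invr_gt0//.
  by rewrite lerXn2r ?nnegrE.
- have := (proj1 maxA) _ _ _ _ (residualP s0) (residualP t0).
  have -> : (x s - e s) - (x t - e t) = (x s - x t) - (e s - e t).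
    by rewrite !opprB addrACA [RHS]addrACA; congr (_ + _); rewrite addrC.
  rewrite -/g1 -/g2 -/v (ipBr Hip) subr_ge0 => /le_trans; apply.
  rewrite (ipBr Hip) -opprB mvt velocityE; last exact: le_lt_trans sc.
  by rewrite (ipNr Hip) mulNr opprK mulrC.
- have [_ c1] := close c (ltW sc) (ltW ct).
  have [_ c2] := close t (ltW st) (lexx t).
  have -> : e c - 2^-1 *: (e s + e t) =
      - (e s - e c) + 2^-1 *: (e s - e t).
    move: (e s) (e t) (e c) => a b d.
    rewrite opprB -[RHS]addrA; congr (d + _).
    rewrite !scalerDr scalerN opprD addrA; congr (_ + _).
    by rewrite -scaleNr -(scaleN1r a) -scalerDl; congr (_ *: _); lra.
  rewrite (le_trans (ler_normD _ _))// normrN normrZ.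
  have -> : `|(2 : R)^-1| = 2^-1 by rewrite ger0_norm.
  have := normr_ge0 (e s - e t); lra.
- have [c2 _] := close t (ltW st) (lexx t).
  have et : `|e t| <= M.
    rewrite -[e t](subrK (e s)) (le_trans (ler_normD _ _))// addrC lerD2l.
    by rewrite distrC ltW.
  have es : `|e s| <= M by rewrite lerDl.
  have -> : g1 *: e s - g2 *: e t = g1 *: (e s - e t) + (g1 - g2) *: e t.
    by move: (e s) (e t) => a b; rewrite scalerBr scalerBl addrA subrK.
  rewrite (le_trans (ler_normD _ _))// !normrZ (gtr0_norm g10) /L mulrDl lerD2l.
  have : `|g1 - g2| <= K / theta * `|e s - e t|.
    rewrite /g1 /g2 !inv_lamE// -mulrBl normrM (gtr0_norm (_ : 0 < theta^-1));
      last by rewrite invr_gt0.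
    rewrite mulrAC ler_pM2r ?invr_gt0//.
    apply: (le_trans (lipK _ _ _ _)); rewrite ?normr_ge0//.
    by rewrite ler_wpM2l// ler_dist_dist.
  by move=> h; rewrite mulrAC ler_pM.
Qed.

Lemma lam_nondecreasing (s t : R) : 0 <= s -> s <= t -> lam s <= lam t.
Proof.
move=> s0 st; have t0 := le_trans s0 st.
rewrite -lef_pV2 ?posrE ?lam0// !inv_lamE// ler_pM2r ?invr_gt0//.
by rewrite lerXn2r ?nnegrE// norm_residual_nonincreasing.
Qed.

(** Monotonicity between [(z, xi)] and the graph point [(x - e, e / lam)], multiplied by [lam]. *)
Lemma graph_le_residual z xi (t : R) : A z xi -> 0 <= t ->
  lam t * ip xi (resolvent A (lam t) (x t) - z) <=
    ip (e t) (x t - z) - `|e t| ^+ 2.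
Proof.
move=> Az t0; have := (proj1 maxA) _ _ _ _ (residualP t0) Az.
rewrite resolventE (ipBl Hip) (ipZl Hip) subr_ge0 -(ler_pM2l (lam0 t0)).
rewrite mulrA mulfV ?gt_eqF ?lam0// mul1r => /le_trans; apply.
by rewrite addrAC (ipBr Hip) (ipxx Hip).
Qed.

(** By the mean value theorem [|x - z|^2] drops by [2 t <e c, x c - z>] over [[0, t]], which is at
    least [2 t |e c|^2], and [|e t| <= |e c|]. *)
Lemma norm_residual_rate z (t : R) : A z 0 -> 0 < t ->
  t * `|e t| ^+ 2 <= `|x 0 - z| ^+ 2 / 2.
Proof.
move=> Az t0.
have [c] : exists2 c, c \in `]0, t[ & `|x t - z| ^+ 2 - `|x 0 - z| ^+ 2 =
    2 * ip (x c - z) ('D_1 x c) * (t - 0).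
  apply: (@MVT _ (fun r => `|x r - z| ^+ 2)
    (fun r => 2 * ip (x r - z) ('D_1 x r))) => //.
    move=> r; rewrite in_itv/= => /andP[r0 _].
    by apply: (is_derive_sqr_dist Hip); exact: dx.
  have cx0t := continuous_subspaceW (@segment_sub_halfline _ 0 t (lexx 0)) cx.
  by apply: within_continuous_sqr_norm => r; exact: (cvgB (cx0t r) (cvg_cst _)).
rewrite in_itv/= => /andP[c0 ct]; rewrite velocityE// subr0 => E.
have := graph_le_residual Az (ltW c0).
rewrite (ip0l Hip) mulr0 subr_ge0 => h.
have ec : `|e t| ^+ 2 <= `|e c| ^+ 2.
  by rewrite lerXn2r ?nnegrE// norm_residual_nonincreasing// ltW.
have : t * `|e t| ^+ 2 <= t * ip (e c) (x c - z).
  by rewrite ler_pM2l// (le_trans ec).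
move: E; rewrite (ipNr Hip) (ipC Hip (x c - z)); have := sqr_ge0 `|x t - z|.
move: (t * `|e t| ^+ 2) => u; lra.
Qed.

Lemma resolvent_continuous (t : R) :
  {within `[0, t], continuous (fun r => resolvent A (lam r) (x r))}.
Proof.
have cJ : {within `[0, +oo[, continuous (fun r => x r - e r)}.
  by move=> r; apply: cvgB; [exact: cx|exact: residual_continuous].
rewrite (_ : (fun r => _) = fun r => x r - e r).
  exact: (continuous_subspaceW (@segment_sub_halfline _ 0 t (lexx 0)) cJ).
by apply/funext => r; rewrite resolventE.
Qed.

Local Notation mu := (@lebesgue_measure R).

Lemma lam_continuous (a b : R) : 0 <= a -> {within `[a, b], continuous lam}.
Proof.
by move=> /(@segment_sub_halfline _ a b)/continuous_subspaceW; apply.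
Qed.

Lemma ip_resolvent_continuous v (t : R) :
  {within `[0, t], continuous (fun r => ip v (resolvent A (lam r) (x r)))}.
Proof.
by move=> r; apply: (cvg_ip Hip); [exact: cvg_cst|exact: resolvent_continuous].
Qed.

Lemma integral_graph_le z xi (t : R) : A z xi -> 0 < t ->
  \int[mu]_(r in `[0, t]) (lam r * ip xi (resolvent A (lam r) (x r) - z)) <=
    `|x 0 - z| ^+ 2 / 2.
Proof.
move=> Az t0.
have sub0 := @segment_sub_halfline _ 0 t (lexx 0).
have cxt := continuous_subspaceW sub0 cx.
have cet := continuous_subspaceW sub0 residual_continuous.
have cxz : {within `[0, t], continuous (fun r => x r - z)}.
  by move=> r; exact: (cvgB (cxt r) (cvg_cst _)).
pose f r := ip (e r) (x r - z).
(* A primitive of [f], because [x' = - e]; [f] dominates the integrand. *)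
pose F r := - 2^-1 *: (`|x r - z| ^+ 2 : R).
have cf : {within `[0, t], continuous f}.
  by move=> r; apply: (cvg_ip Hip); [exact: cet|exact: cxz].
have cF : {within `[0, t], continuous F}.
  move=> r; apply: cvgZr.
  exact: (within_continuous_sqr_norm cxz).
have dF (r : R) : 0 < r -> is_derive r 1 F (f r).
  move=> r0; have := is_derive_sqr_dist Hip z (dx r0).
  rewrite velocityE// => D.
  have <- : - 2^-1 *: (2 * ip (x r - z) (- e r)) = f r.
    by rewrite /f (ipNr Hip) (ipC Hip (e r)) /GRing.scale/=; field.
  exact: is_deriveZ.
have /(continuous_within_itvP _ t0)[_ F0 Ft] := cF.
have FTC : \int[mu]_(r in `[0, t]) f r = F t - F 0.
  rewrite /Rintegral (@continuous_FTC2 _ _ F _ _ t0 cf)//.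
    split; [|exact: F0|exact: Ft] => r; rewrite in_itv/= => /andP[r0 _].
    by case: (dF r r0).
  move=> r; rewrite in_itv/= => /andP[r0 _]; rewrite derive1E.
  by case: (dF r r0) => _ ->.
apply: (@le_trans _ _ (\int[mu]_(r in `[0, t]) f r)).
  apply: le_Rintegral => //.
  - apply: within_segment_integrable => r.
    apply: cvgM; first exact: lam_continuous.
    apply: (cvg_ip Hip); first exact: cvg_cst.
    by apply: cvgB; [exact: resolvent_continuous|exact: cvg_cst].
  - exact: within_segment_integrable.
  - move=> r; rewrite /= in_itv/= => /andP[r0 _].
    apply: (le_trans (graph_le_residual Az r0)).
    by rewrite gerBl sqr_ge0.
rewrite FTC /F /GRing.scale/=; have := sqr_ge0 `|x t - z|; lra.
Qed.

(** Only the half [[t / 2, t]] is kept, where [lam] is at least [lam (t / 2)]. *)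
Lemma integral_lam_ge (t : R) : 0 < t ->
  t / 2 * lam (t / 2) <= \int[mu]_(r in `[0, t]) lam r.
Proof.
move=> t0; have t20 : 0 < t / 2 by rewrite divr_gt0.
have t2t : t / 2 <= t by lra.
have int2 := within_segment_integrable (@lam_continuous (t / 2) t (ltW t20)).
have int0 := within_segment_integrable (@lam_continuous 0 t (lexx 0)).
apply: (@le_trans _ _ (\int[mu]_(r in `[t / 2, t]) lam r)).
  have -> : t / 2 * lam (t / 2) = \int[mu]_(r in `[t / 2, t]) lam (t / 2).
    rewrite Rintegral_cst//= lebesgue_measure_itv/= lte_fin.
    rewrite (_ : (t / 2 < t) = true); last by apply/idP; lra.
    by rewrite -EFinB/= mulrC; congr (_ * _); lra.
  apply: le_Rintegral => //.
    by apply: within_segment_integrable => r; exact: cvg_cst.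
  move=> r; rewrite /= in_itv/= => /andP[tr _].
  by apply: lam_nondecreasing => //; exact: ltW.
rewrite /Rintegral fine_le ?integrable_fin_num//.
apply: ge0_subset_integral => //.
- exact: measurable_int int0.
- by move=> r; rewrite /= in_itv/= lee_fin => /andP[r0 _]; rewrite ltW// lam0.
- move=> r; rewrite /= !in_itv/= => /andP[tr ->].
  by rewrite andbT (le_trans _ tr)// ltW.
Qed.

Lemma gap_weighted_avg_le z xi (t : R) w : A z xi -> 0 < t ->
  is_weighted_avg ip lam (fun s => resolvent A (lam s) (x s)) t w ->
  ip xi (w - z) <= `|x 0 - z| ^+ 2 / (t * lam (t / 2)).
Proof.
move=> Az t0 avg; have := integral_graph_le Az t0.
pose I := \int[mu]_(r in `[0, t]) lam r.
have P0 : 0 < t / 2 * lam (t / 2).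
  by rewrite mulr_gt0 ?lam0 ?divr_gt0// ltW// divr_gt0.
have IP : t / 2 * lam (t / 2) <= I := integral_lam_ge t0.
have I0 : 0 < I by exact: lt_le_trans IP.
have clam0 : {within `[0, t], continuous lam} by exact: lam_continuous.
(* The weak average is tested against [xi]. *)
have -> : \int[mu]_(r in `[0, t])
    (lam r * ip xi (resolvent A (lam r) (x r) - z)) = I * ip xi (w - z).
  rewrite (ipBr Hip) avg -/I mulrBr mulrA mulfV ?gt_eqF// mul1r.
  under eq_Rintegral => r _ do rewrite (ipBr Hip) mulrBr.
  rewrite RintegralB//; first last.
  - by apply: within_segment_integrable => r; apply: cvgMl; exact: clam0.
  - apply: within_segment_integrable => r; apply: cvgM; first exact: clam0.
    exact: ip_resolvent_continuous.
  by rewrite RintegralZr//; exact: within_segment_integrable.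
set q := ip xi (w - z); set B := `|x 0 - z| ^+ 2 => IqB.
have B0 : 0 <= B by exact: sqr_ge0.
(* The lower bound on [I] helps only for positive [q]; otherwise the nonnegative right side
   suffices. *)
have [q0|q0] := leP q 0.
  by rewrite (le_trans q0)// divr_ge0// mulr_ge0 ?ltW// lam0// divr_ge0// ltW.
rewrite ler_pdivlMr; last by rewrite mulr_gt0// lam0// divr_ge0// ltW.
have : t / 2 * lam (t / 2) * q <= I * q by rewrite ler_pM2r.
lra.
Qed.

End Trajectory.

(** * From the bound on [t |e|^2] to the two rates *)

Lemma expr_powR_le (R : realType) (a B t : R) m : 0 <= a -> 0 <= B -> 0 < t ->
  t * a ^+ 2 <= B -> a ^+ m <= B `^ (m%:R / 2) * t `^ (- (m%:R / 2)).
Proof.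
move=> a0 B0 t0 tB.
have -> : a ^+ m = (a ^+ 2) `^ (m%:R / 2).
  rewrite -(powR_mulrn m a0) -(powR_mulrn 2 a0) -powRrM; congr (_ `^ _).
  by rewrite mulrC divfK.
have -> : t `^ (- (m%:R / 2)) = (t^-1) `^ (m%:R / 2).
  by rewrite -(powR_inv1 (ltW t0)) -powRrM mulN1r.
rewrite -powRM ?invr_ge0 ?(ltW t0)//.
apply: ge0_ler_powR; rewrite ?nnegrE ?divr_ge0 ?sqr_ge0 ?(ltW t0)//.
by rewrite ler_pdivlMr// mulrC.
Qed.

Unset Implicit Arguments.
Set Strict Implicit.

Theorem theorem3p3 (R : realType) (H : completeNormedModType R)
  (ip : H -> H -> R) (A : H -> set H) (theta : R) (p : nat)
  (x : R -> H) (lam : R -> R) :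
  is_inner_product ip ->
  maximal_monotone ip A ->
  (exists x0, A x0 0) ->
  closed (dom A) ->
  bounded_set (dom A) ->
  0 < theta ->
  (1 <= p)%N ->
  (* (x, lam) is a global solution on [0, +oo) *)
  (forall t, 0 <= t -> 0 < lam t) ->
  {within `[0, +oo[, continuous x} ->
  {within `[0, +oo[, continuous lam} ->
  (forall t, 0 < t -> derivable x t 1) ->
  (forall t, 0 < t ->
     'D_1 x t + x t - resolvent A (lam t) (x t) = 0) ->
  (forall t, 0 <= t ->
     lam t * `|resolvent A (lam t) (x t) - x t| ^+ p.-1 = theta) ->
  ~ A (x 0) 0 ->
  (exists C T : R, forall t, T <= t -> forall w,
     is_weighted_avg ip lam (fun s => resolvent A (lam s) (x s)) t w ->
     (gap ip A w <= (C * t `^ (- ((p.+1)%:R / 2)))%:E)%E) /\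
  (exists C T : R, forall t, T <= t ->
     (res A (resolvent A (lam t) (x t)) <= (C * t `^ (- (p%:R / 2)))%:E)%E).
Proof.
move=> Hip maxA [x0 Ax0] _ [M [_ bM]] theta0.
(* From here [p = n + 1], so the exponents are [(n + 2) / 2] and [(n + 1) / 2]. *)
case: p => // n _ lam0 cx clam dx ode law _; rewrite /= in law.
have neA : exists y v, A y v by exists x0, 0.
pose B := `|x 0 - x0| ^+ 2 / 2.
have B0 : 0 <= B by rewrite divr_ge0 ?sqr_ge0.
have rate t : 0 < t -> t * `|residual A lam x t| ^+ 2 <= B.
  exact: (norm_residual_rate Hip maxA neA theta0 lam0 cx clam dx ode law Ax0).
split.
  (* Bounds [|x 0 - z|^2] uniformly over the domain; [bounded_set] bounds norms by any number
     strictly above [M], hence [M + 1]. *)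
  pose D := (`|x 0| + (M + 1)) ^+ 2.
  (* The factor [1 / theta] comes from [1 / lam (t / 2)], and [2 * B] from the residual bound at
     time [t / 2]. *)
  exists (D / theta * (2 * B) `^ (n%:R / 2)), 1 => t t1 w avg.
  have t0 : 0 < t by exact: lt_le_trans t1.
  have t20 : 0 < t / 2 by rewrite divr_gt0.
  apply: ge_ereal_sup => _ [z [xi [Az ->]]]; rewrite lee_fin.
  apply: (le_trans (gap_weighted_avg_le Hip maxA neA theta0 lam0 cx clam dx ode
    law Az t0 avg)).
  have zD : `|x 0 - z| ^+ 2 <= D.
    have zM : `|z| <= M + 1 by apply: bM; [rewrite ltrDl|exists xi].
    have le1 : `|x 0 - z| <= `|x 0| + (M + 1).
      by rewrite (le_trans (ler_normB _ _))// lerD2l.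
    by rewrite lerXn2r ?nnegrE// (le_trans _ le1).
  rewrite invfM (inv_lamE theta0 law (ltW t20)).
  have := rate _ t20; set a := `|_| => ta.
  have an : a ^+ n <= (2 * B) `^ (n%:R / 2) * t `^ (- (n%:R / 2)).
    by apply: expr_powR_le; rewrite ?normr_ge0 ?mulr_ge0//; lra.
  (* One factor [t^-1] comes from the length of the interval, the rest from [1 / lam]. *)
  have -> : t `^ (- (n.+2%:R / 2)) = t^-1 * t `^ (- (n%:R / 2)).
    rewrite -(powR_inv1 (ltW t0)) -powRD; last first.
      by apply/implyP => _; rewrite gt_eqF.
    have -> : (n.+2%:R : R) = 2 + n%:R by exact: (natrD R 2 n).
    by congr (_ `^ _); field.
  have P : 0 <= (theta * t)^-1 by rewrite invr_ge0 mulr_ge0 ?ltW.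
  rewrite (_ : `|x 0 - z| ^+ 2 * (t^-1 * (a ^+ n / theta)) =
    `|x 0 - z| ^+ 2 * a ^+ n * (theta * t)^-1); last by rewrite invfM; ring.
  rewrite (_ : D / theta * _ * _ = D * ((2 * B) `^ (n%:R / 2) *
    t `^ (- (n%:R / 2))) * (theta * t)^-1); last by rewrite invfM; ring.
  by rewrite ler_wpM2r// ler_pM ?sqr_ge0 ?exprn_ge0 ?normr_ge0.
exists (B `^ (n.+1%:R / 2) / theta), 1 => t t1.
have t0 : 0 < t by exact: lt_le_trans t1.
apply: le_trans (ereal_inf_lbound _) _.
  (* This element of [A] at the resolvent has norm [|e|^(n+1) / theta]. *)
  exists ((lam t)^-1 *: residual A lam x t); split; last by [].
  have := residualP x Hip maxA neA lam0 (ltW t0).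
  by rewrite -resolventE.
rewrite lee_fin normrZ gtr0_norm ?invr_gt0 ?lam0 ?(ltW t0)//.
rewrite (inv_lamE theta0 law (ltW t0)) mulrAC -exprSr [leRHS]mulrAC.
rewrite ler_pM2r ?invr_gt0//.
by apply: expr_powR_le => //; exact: rate.
Qed.
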